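(* Let $K\subseteq\mathbb{R}^n$ be a nonempty closed convex cone, $c\in\mathbb{R}^n$, $b\in\mathbb{R}^m$, and let $A\in\mathbb{R}^{m\times n}$ have full rank with $m\le n$. Let $\tilde T$ and $D$ be as defined in the context, and consider the iteration $$z^{k+1}=\tilde T(z^k)-\gamma Dc,\qquad k=0,1,\dots,$$ with any starting point $z^0\in\mathbb{R}^n$ and any $\gamma>0$. If (D) is feasible, then $z^k$ converges. If (D) is infeasible, then $z^k$ diverges in that $\|z^k\|\to\infty$.
   Context: A set $K\subseteq\mathbb{R}^n$ is a cone if $K=\lambda K$ for every $\lambda>0$; its dual cone is $K^*=\{u\in\mathbb{R}^n\mid u^Tv\ge0\text{ for all }v\in K\}$. $\|\cdot\|$ is the Euclidean norm. (D) is the problem: maximize $b^Ty$ subject to $A^Ty+s=c$, $s\in K^*$, over $(y,s)\in\mathbb{R}^m\times\mathbb{R}^n$. It is feasible if there is $(y,s)$ with $A^Ty+s=c$ and $s\in K^*$, and infeasible otherwise. For a nonempty closed convex set $C$, $P_C$ is the Euclidean projection onto $C$ and $R_C(x)=2P_C(x)-x$. $\mathcal{N}(A)$ is the null space of $A$. Define $\tilde T(z)=\frac12\left(z+R_{\mathcal{N}(A)}(R_K(z))\right)$ and $D=I-A^T(AA^T)^{-1}A$ (the matrix $D$ is distinct from the problem (D)). *)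

(* Defs.v *)
(* Vectors of R^n are columns 'cV[R]_n. *)
From HB Require Import structures.
From mathcomp Require Export all_boot all_order all_algebra.
From mathcomp Require Export all_classical all_reals all_analysis.

Set Implicit Arguments.
Unset Strict Implicit.
Unset Printing Implicit Defensive.

Export Order.TTheory GRing.Theory Num.Theory.
Export numFieldNormedType.Exports.
Local Open Scope classical_set_scope.
Local Open Scope ring_scope.

Definition dotp (R : realType) (n : nat) (u v : 'cV[R]_n) : R :=
  (u^T *m v) 0 0.

(* The library norm on matrices is the sup norm, hence this definition; the
   library topology on 'cV[R]_n is the usual topology of R^n. *)
Definition enorm (R : realType) (n : nat) (x : 'cV[R]_n) : R :=
  Num.sqrt (dotp x x).

Definition is_cone (R : realType) (n : nat) (K : set 'cV[R]_n) : Prop :=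
  forall l : R, 0 < l -> K = [set l *: x | x in K].

Definition dual_cone (R : realType) (n : nat) (K : set 'cV[R]_n) :
    set 'cV[R]_n :=
  [set u | forall v, K v -> 0 <= dotp u v].

(* Feasible pairs of: maximize b^T y subject to A^T y + s = c, s \in K^*.
   The objective vector b plays no role in feasibility. *)
Definition dual_feasible_set (R : realType) (m n : nat) (K : set 'cV[R]_n)
    (A : 'M[R]_(m, n)) (c : 'cV[R]_n) : set ('cV[R]_m * 'cV[R]_n) :=
  [set ys | A^T *m ys.1 + ys.2 = c /\ dual_cone K ys.2].

Definition dual_feasible (R : realType) (m n : nat) (K : set 'cV[R]_n)
    (A : 'M[R]_(m, n)) (c : 'cV[R]_n) : Prop :=
  dual_feasible_set K A c !=set0.

(* Meaningful for C nonempty, closed and convex, when the minimizer exists and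
   is unique; x is the junk value returned when there is no minimizer. *)
Definition proj (R : realType) (n : nat) (C : set 'cV[R]_n) (x : 'cV[R]_n) :
    'cV[R]_n :=
  xget x [set p | C p /\ forall q, C q -> enorm (x - p) <= enorm (x - q)].

Definition reflector (R : realType) (n : nat) (C : set 'cV[R]_n) (x : 'cV[R]_n) :
    'cV[R]_n :=
  2 *: proj C x - x.

Definition null_space (R : realType) (m n : nat) (A : 'M[R]_(m, n)) :
    set 'cV[R]_n :=
  [set x | A *m x = 0].

Definition Ttilde (R : realType) (m n : nat) (K : set 'cV[R]_n)
    (A : 'M[R]_(m, n)) (z : 'cV[R]_n) : 'cV[R]_n :=
  2^-1 *: (z + reflector (null_space A) (reflector K z)).

Definition Dmx (R : realType) (m n : nat) (A : 'M[R]_(m, n)) : 'M[R]_n :=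
  1%:M - A^T *m invmx (A *m A^T) *m A.

(* Main.v *)
Require Import Defs.
From mathcomp Require Import lra ring.

Set Implicit Arguments.
Unset Strict Implicit.
Unset Printing Implicit Defensive.

Local Open Scope classical_set_scope.
Local Open Scope ring_scope.

(** The map S z := Ttilde z - gamma *: D c is a Douglas-Rachford operator: the
    average of the identity and of a composition of two reflections, up to a
    translation. Reflections across closed convex sets are nonexpansive, so
    S is firmly nonexpansive ([firmly_nonexpansive_average],
    [firmly_nonexpansive_translate]).

    The fixed points of S encode dual feasibility. If A^T y + s = c with s in
    K^*, then - gamma s projects to 0 on K and is fixed by S
    ([dual_feasible_fixed]). Conversely, for a fixed point z the vector
    s := (P_K z - z) / gamma lies in K^* because P_K z - z always does, and the
    fixed point equation makes s - c orthogonal to the null space of A, that is,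
    a combination of the rows of A ([fixed_dual_feasible]).

    It remains to see that the orbits of a firmly nonexpansive map converge when
    it has a fixed point and tend to infinity in norm when it has none. Both
    follow from one fact: a cluster point w of an orbit is a fixed point
    ([orbit_cluster_fixed]). Indeed S^k w returns arbitrarily close to w. The
    step lengths |S^k w - S^(k+1) w| are nonincreasing and return to their
    initial value in the limit, hence are constant; equality in firm
    nonexpansiveness then forces all the steps to be the same vector v. So
    S^k w = w + k v, and the recurrence of w leaves only v = 0
    ([recurrent_fixed]).

    If the norms of an orbit do not tend to infinity, the orbit visits some ball
    infinitely often and so has a cluster point by compactness
    ([not_cvg_pinfty_cluster]). Without fixed points this is impossible. With
    a fixed point the orbit is bounded, so it has a cluster point, itself fixed;
    the distance of the orbit to it is nonincreasing and has a subsequence going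
    to 0, hence the orbit converges to it. *)

(** * Euclidean inner product and norm *)

Section Euclidean.
Context {R : realType} {n : nat}.
Implicit Types (x y u v : 'cV[R]_n) (t : R).

Lemma dotpE x y : dotp x y = \sum_i x i 0 * y i 0.
Proof. by rewrite /dotp mxE; apply: eq_bigr => i _; rewrite mxE. Qed.

Lemma dotpC x y : dotp x y = dotp y x.
Proof. by rewrite !dotpE; apply: eq_bigr => i _; rewrite mulrC. Qed.

Lemma dotpDr x u v : dotp x (u + v) = dotp x u + dotp x v.
Proof. by rewrite /dotp mulmxDr mxE. Qed.

Lemma dotpZr x t u : dotp x (t *: u) = t * dotp x u.
Proof. by rewrite /dotp -scalemxAr mxE. Qed.

Lemma dotpNr x u : dotp x (- u) = - dotp x u.
Proof. by rewrite -scaleN1r dotpZr mulN1r. Qed.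

Lemma dotpDl u v x : dotp (u + v) x = dotp u x + dotp v x.
Proof. by rewrite dotpC dotpDr ![dotp x _]dotpC. Qed.

Lemma dotpZl t u x : dotp (t *: u) x = t * dotp u x.
Proof. by rewrite dotpC dotpZr dotpC. Qed.

Lemma dotpNl u x : dotp (- u) x = - dotp u x.
Proof. by rewrite dotpC dotpNr dotpC. Qed.

Definition dotp_linE := (dotpDl, dotpDr, dotpNl, dotpNr, dotpZl, dotpZr).

Lemma dotpxx_ge0 x : 0 <= dotp x x.
Proof. by rewrite dotpE sumr_ge0// => i _; rewrite -expr2 sqr_ge0. Qed.

Lemma dotpxx_eq0 x : dotp x x = 0 -> x = 0.
Proof.
rewrite dotpE => /eqP; rewrite psumr_eq0 => [/allP x0|i _]; last first.
  by rewrite -expr2 sqr_ge0.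
apply/matrixP => i j; rewrite (ord1 j) mxE; apply/eqP.
by have := x0 i (mem_index_enum _); rewrite /= mulf_eq0 orbb.
Qed.

Lemma enorm_ge0 x : 0 <= enorm x.
Proof. exact: sqrtr_ge0. Qed.

Lemma sqr_enorm x : enorm x ^+ 2 = dotp x x.
Proof. by rewrite sqr_sqrtr ?dotpxx_ge0. Qed.

Lemma ler_enorm x y : (enorm x <= enorm y) = (dotp x x <= dotp y y).
Proof. by rewrite ler_sqrt ?dotpxx_ge0. Qed.

Lemma enorm_eq0 x : enorm x = 0 -> x = 0.
Proof. by move=> x0; apply: dotpxx_eq0; rewrite -sqr_enorm x0 expr0n. Qed.

Lemma enorm0 : enorm (0 : 'cV[R]_n) = 0.
Proof. by rewrite /enorm /dotp mulmx0 mxE sqrtr0. Qed.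

Lemma enormN x : enorm (- x) = enorm x.
Proof. by rewrite /enorm dotpNl dotpNr opprK. Qed.

Lemma enorm_distC x y : enorm (x - y) = enorm (y - x).
Proof. by rewrite -enormN opprB. Qed.

(** Cauchy-Schwarz, by expanding the square of |y| x - |x| y. *)
Lemma dotp_le_enorm x y : dotp x y <= enorm x * enorm y.
Proof.
have := enorm_ge0 y; rewrite le_eqVlt => /predU1P[/esym y0|y0].
  by rewrite (enorm_eq0 y0) /dotp mulmx0 mxE enorm0 mulr0.
have := enorm_ge0 x; rewrite le_eqVlt => /predU1P[/esym x0|x0].
  by rewrite (enorm_eq0 x0) /dotp trmx0 mul0mx mxE enorm0 mul0r.
have := dotpxx_ge0 (enorm y *: x - enorm x *: y).
rewrite !dotp_linE (dotpC y x) -!sqr_enorm => h.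
rewrite -(ler_pM2l (mulr_gt0 x0 y0)); nra.
Qed.

Lemma enormD x y : enorm (x + y) <= enorm x + enorm y.
Proof.
rewrite -(@ler_pXn2r _ 2) ?nnegrE ?addr_ge0 ?enorm_ge0//.
rewrite sqr_enorm !dotp_linE (dotpC y x) sqrrD !sqr_enorm.
have := dotp_le_enorm x y; lra.
Qed.

Lemma enormZ t x : enorm (t *: x) = `|t| * enorm x.
Proof.
rewrite /enorm dotpZl dotpZr mulrA -expr2 sqrtrM ?sqr_ge0//.
by rewrite sqrtr_sqr.
Qed.

Lemma enorm_dist_triangle y x u : enorm (x - u) <= enorm (x - y) + enorm (y - u).
Proof. by rewrite -{1}(subrK y x) -addrA enormD. Qed.

End Euclidean.

(** * Euclidean norm and topology *)

Section Topology.
Context {R : realType} {n : nat}.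
Implicit Types x : 'cV[R]_n.

(** The norm behind the topology is the sup norm: this inequality transfers
    limits, and the continuity of the Euclidean norm transfers them back. *)
Lemma norm_le_enorm x : `|x| <= enorm x.
Proof.
rewrite [leLHS]mx_normrE; apply/bigmax_leP; split=> [|i _].
  exact: enorm_ge0.
rewrite -sqrtr_sqr ler_sqrt ?dotpxx_ge0// dotpE (bigD1 i.1)//= (ord1 i.2).
by rewrite -expr2 lerDl sumr_ge0// => j _; rewrite -expr2 sqr_ge0.
Qed.

Lemma continuous_enorm : continuous (@enorm R n).
Proof.
move=> x; apply: (@continuous_comp _ _ _ (fun x => dotp x x) Num.sqrt).
  rewrite (_ : (fun x => dotp x x) = \sum_i (fun x => x i 0 * x i 0)).
    apply: (@big_ind _ (fun f : 'cV[R]_n -> R => f @ x --> f x)).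
    - exact: cst_continuous.
    - by move=> f g fx gx; exact: (cvgD fx gx).
    - move=> i _; have ci := @coord_continuous R n 1 i 0 x.
      exact: (cvgM ci ci).
  by apply/funext => y; rewrite dotpE fct_sumE.
exact: sqrt_continuous.
Qed.

Lemma norm_trmx_le p q (M : 'M[R]_(p, q)) : `|M^T| <= `|M|.
Proof.
rewrite ![`|_|]mx_normrE; apply/bigmax_leP; split=> [|[i j] _].
  exact: bigmax_ge_id.
by rewrite mxE; apply: (@le_bigmax _ _ _ 0 (fun ij => `|M ij.1 ij.2|) (j, i)).
Qed.

Lemma continuous_trmx p q : continuous (@trmx R p q).
Proof.
move=> M B /nbhs_ballP[e e0 eB]; apply/nbhs_ballP; exists e => // N.
rewrite -ball_normE /= => MN; apply: eB; rewrite -ball_normE /= -linearB/=.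
exact: le_lt_trans (norm_trmx_le _) MN.
Qed.

(** Heine-Borel, transported from row vectors by transposition, which is an
    isometry for the sup norm. *)
Lemma compact_closed_enorm_ball (C : set 'cV[R]_n) (M : R) :
  closed C -> compact [set x | C x /\ enorm x <= M].
Proof.
move=> Cc; set B := [set x | _].
have Bc : closed B.
  apply: closedI => //.
  apply: (@preimage_closed _ _ (@enorm R n) [set y | y <= M]).
    by move=> x _; exact: continuous_enorm.
  exact: closed_le.
have -> : B = [set x^T | x in [set v : 'rV[R]_n | B v^T]].
  apply/seteqP; split=> [x Bx|_ [v Bv <-]//].
  by exists x^T; rewrite /= trmxK.
apply: continuous_compact; first exact/continuous_subspaceT/continuous_trmx.
apply: bounded_closed_compact; last first.
  by apply: preimage_closed => // x _; exact: continuous_trmx.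
exists M; split; first exact: num_real.
move=> N MN v [_ vM]; apply: le_trans (ltW MN); apply: le_trans vM.
by apply: le_trans (norm_le_enorm _); rewrite -{1}[v]trmxK norm_trmx_le.
Qed.

Lemma cluster_enorm (z : nat -> 'cV[R]_n) w : cluster (z k @[k --> \oo]) w ->
  forall e N, 0 < e -> exists2 k, (N <= k)%N & enorm (z k - w) < e.
Proof.
move=> zw e N e0.
have [||_ [/= [k Nk <-] kw]] := zw [set z k | k in [set k | (N <= k)%N]]
  [set x | enorm (x - w) < e].
- by exists N => // k Nk; exists k.
- have : nbhs (0 : 'cV[R]_n) [set x | enorm x < e].
    apply: (continuous_enorm (x := 0) (t := [set r | r < e])).
    by rewrite enorm0; exact: lt_nbhsl.
  move=> /nbhs_ballP[d d0 dB]; apply/nbhs_ballP; exists d => // x.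
  rewrite -ball_normE /= distrC => xw; apply: dB.
  by rewrite -ball_normE /= sub0r normrN.
by exists k.
Qed.

Lemma enorm_cvg (z : nat -> 'cV[R]_n) w :
  (forall e, 0 < e -> \forall k \near \oo, enorm (z k - w) < e) ->
  z k @[k --> \oo] --> w.
Proof.
move=> h; apply/cvgrPdist_lt => e e0; near=> k.
rewrite distrC; apply: le_lt_trans (norm_le_enorm _) _.
by near: k; exact: h.
Unshelve. all: by end_near. Qed.

Lemma not_cvg_pinfty_cluster (z : nat -> 'cV[R]_n) :
  ~ (enorm (z k) @[k --> \oo] --> +oo) ->
  exists w, cluster (z k @[k --> \oo]) w.
Proof.
move=> /cvgryPge/existsNP[M zM].
(* the subsequence staying in the ball of radius M, as a filter *)
pose F := within [set k | enorm (z k) <= M] (nbhs \oo).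
have FF : ProperFilter F.
  split; last exact: within_filter.
  move=> F0; apply: zM; near=> k.
  rewrite leNgt; apply/negP => /ltW; near: k; exact: F0.
have [|w [_ wF]] := @compact_closed_enorm_ball setT M closedT (z @ F) _.
  by apply: (@nearW _ \oo) => k kM; split.
exists w; apply: cvg_cluster wF => B zB.
by apply: (@filterS _ \oo _ (z @^-1` B)) zB => k zkB _.
Unshelve. all: by end_near. Qed.

End Topology.

(** * Projections and reflections *)

Section Projection.
Context {R : realType} {n : nat}.
Implicit Types (C : set 'cV[R]_n) (p q x y : 'cV[R]_n).

(** The variational characterization of the projection p of x: the angle at p
    between x and every point of C is obtuse. *)
Definition obtuse_at C x p := C p /\ forall q, C q -> dotp (x - p) (q - p) <= 0.

Definition has_obtuse_points C := forall x, exists p, obtuse_at C x p.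

(** The obtuse angle makes |x - q|^2 exceed |x - p|^2 by at least |q - p|^2, which
    gives both minimality and uniqueness. *)
Lemma proj_eq C x p : obtuse_at C x p -> proj C x = p.
Proof.
move=> [Cp obt].
have min_p q : C q -> enorm (x - p) <= enorm (x - q).
  move=> /obt; rewrite ler_enorm; have := dotpxx_ge0 (q - p).
  rewrite !dotp_linE (dotpC p x) (dotpC q x) (dotpC p q); lra.
have [Cq min_q] : [set p | C p /\ forall q, C q -> enorm (x - p) <= enorm (x - q)]
    (proj C x).
  by apply: xgetPex; exists p.
set q := proj C x in Cq min_q *.
apply/eqP; rewrite -subr_eq0; apply/eqP/dotpxx_eq0/le_anti.
rewrite dotpxx_ge0 andbT; have := min_q _ Cp; have := obt _ Cq.
rewrite ler_enorm !dotp_linE (dotpC p x) (dotpC q x) (dotpC p q); lra.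
Qed.

Lemma proj_obtuse C x : has_obtuse_points C -> obtuse_at C x (proj C x).
Proof. by move=> /(_ x)[p px]; rewrite (proj_eq px). Qed.

(** Summing the two obtuse angle conditions gives |p - q|^2 <= <x - y, p - q> for
    the projections p, q of x, y; this is the claim once the squares are
    expanded. *)
Lemma reflector_nonexpansive C x y : has_obtuse_points C ->
  dotp (reflector C x - reflector C y) (reflector C x - reflector C y) <=
  dotp (x - y) (x - y).
Proof.
move=> Cobt; rewrite /reflector.
have [Cp px] := proj_obtuse x Cobt; have [Cq qy] := proj_obtuse y Cobt.
move: (px _ Cq) (qy _ Cp); set p := proj C x; set q := proj C y.
rewrite !dotp_linE (dotpC p x) (dotpC q x) (dotpC p q) (dotpC p y) (dotpC q y).
rewrite (dotpC y x); lra.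
Qed.

(** A nearest point exists by compactness of the points of C that are not too
    far away. If the angle at it were acute, a small step towards q would come
    closer to x. *)
Lemma closed_convex_has_obtuse_points C : C !=set0 -> closed C -> convex_set C ->
  has_obtuse_points C.
Proof.
move=> [x0 Cx0] Cclosed Cconvex x.
pose B : set 'cV[R]_n := [set p | C p /\ enorm p <= enorm x + enorm (x - x0)].
have Bcompact : compact B by exact: compact_closed_enorm_ball.
have [p Cp min_p] : exists2 p, C p & forall q, C q -> enorm (x - p) <= enorm (x - q).
  have Bx0 : B x0.
    by split=> //; have := enormD x (x0 - x); rewrite addrC subrK enorm_distC.
  have dist_cont : continuous (fun p : 'cV[R]_n => enorm (x - p)).
    move=> p; apply: (@continuous_comp _ _ _ (fun p => x - p) (@enorm R n)).
      by apply: (@cvgB _ _ _ (nbhs p)); [exact: cvg_cst|exact: cvg_id].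
    exact: (@continuous_enorm R n (x - p)).
  have [|p /set_mem[Cp _] min_p] :=
    @compact_EVT_min _ _ _ B _ Bcompact (continuous_subspaceT dist_cont).
    by exists x0.
  exists p => // q Cq; case: (leP (enorm q) (enorm x + enorm (x - x0))) => [qB|qB].
    by apply: min_p; rewrite inE.
  apply: le_trans (min_p x0 (mem_set Bx0)) _.
  have := enormD x (q - x); rewrite addrC subrK (enorm_distC q).
  by move: qB => /ltW; lra.
exists p; split=> // q Cq; rewrite leNgt; apply/negP => g_gt0.
set g := dotp _ _ in g_gt0; set d := dotp (q - p) (q - p).
have d_ge0 : 0 <= d by exact: dotpxx_ge0.
have den_gt0 : 0 < 2 * g + d by lra.
(* the step t minimizing -2 t g + t^2 d would be g / d, but d could vanish and
   t must stay below 1 *)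
pose t := g / (2 * g + d).
have t0 : 0 <= t by rewrite divr_ge0 // ltW.
have t1 : t <= 1 by rewrite ler_pdivrMr // mul1r; lra.
(* hence t d <= g, while minimality at the step t gives 2 g <= t d *)
have tE : t * (2 * g + d) = g by rewrite divfK // gt_eqF.
have Ct : C (p + t *: (q - p)).
  have := Cconvex q p (Itv01 t0 t1).
  rewrite !inE => /(_ Cq Cp); congr C.
  rewrite [LHS](_ : _ = t *: q + (1 - t) *: p) //.
  by rewrite scalerBr scalerBl scale1r addrCA addrA addrAC.
have := min_p _ Ct; rewrite ler_enorm opprD addrA.
rewrite (dotpDl (x - p)) !(dotpDr _ (x - p)) !dotpNl !dotpNr !dotpZl !dotpZr.
rewrite (dotpC (q - p) (x - p)) -/g -/d.
nra.
Qed.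

End Projection.

(** * Firmly nonexpansive iterations *)

Section FirmlyNonexpansive.
Context {R : realType} {n : nat}.
Implicit Types (S : 'cV[R]_n -> 'cV[R]_n) (w x y : 'cV[R]_n).

(** Nonexpansiveness with the defect in the displacements x - S x accounted for;
    equivalently, 2 S - id is nonexpansive. *)
Definition firmly_nonexpansive S := forall x y,
  enorm (S x - S y) ^+ 2 + enorm ((x - S x) - (y - S y)) ^+ 2
  <= enorm (x - y) ^+ 2.

(** The parallelogram identity for x - y and N x - N y. *)
Lemma firmly_nonexpansive_average N :
  (forall x y, dotp (N x - N y) (N x - N y) <= dotp (x - y) (x - y)) ->
  firmly_nonexpansive (fun x => 2^-1 *: (x + N x)).
Proof.
move=> Nne x y; rewrite !sqr_enorm; have := Nne x y.
move: (N x) (N y) => u v.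
rewrite !dotp_linE (dotpC y x) (dotpC u x) (dotpC v x) (dotpC u y) (dotpC v y).
rewrite (dotpC v u); lra.
Qed.

Lemma firmly_nonexpansive_translate S a : firmly_nonexpansive S ->
  firmly_nonexpansive (fun x => S x - a).
Proof.
move=> Sf x y; have := Sf x y.
have -> : S x - a - (S y - a) = S x - S y by rewrite opprD opprK addrACA addNr addr0.
have -> : x - (S x - a) - (y - (S y - a)) = x - S x - (y - S y).
  by rewrite !opprD !opprK !addrA; apply/matrixP => i j; rewrite !mxE; ring.
by [].
Qed.

Section Iterates.
Variables (S : 'cV[R]_n -> 'cV[R]_n) (Sfirm : firmly_nonexpansive S).

Lemma firmly_nonexpansive_enorm x y : enorm (S x - S y) <= enorm (x - y).
Proof.
rewrite -(@ler_pXn2r _ 2) ?nnegrE ?enorm_ge0//; apply: le_trans (Sfirm x y).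
by rewrite lerDl sqr_ge0.
Qed.

Lemma iter_nonexpansive k x y : enorm (iter k S x - iter k S y) <= enorm (x - y).
Proof.
elim: k => //= k IH; exact: le_trans (firmly_nonexpansive_enorm _ _) IH.
Qed.

(** Recurrence makes the step lengths constant. Constant step lengths turn firm nonexpansiveness into an equality of consecutive steps, so
    the orbit of w runs along a straight line and cannot return unless it stands
    still. *)
Lemma recurrent_fixed w :
  (forall e N, 0 < e -> exists2 k, (N < k)%N & enorm (iter k S w - w) < e) ->
  S w = w.
Proof.
move=> rec; pose d k := enorm (iter k S w - iter k.+1 S w).
have d_noninc i j : (i <= j)%N -> d j <= d i.
  move=> /subnK <-; elim: (j - i)%N => //= k IH.
  by apply: le_trans IH; exact: firmly_nonexpansive_enorm.
have dE k : d k = d 0.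
  apply/le_anti; rewrite d_noninc//=; apply/ler_addgt0Pr => e e0.
  (* at a late return time j both S^j w and S^(j+1) w are close to their start *)
  have [j kj jw] := rec (e / 2) k (divr_gt0 e0 (ltr0Sn _ _)).
  apply: le_trans (enorm_dist_triangle (iter j S w) _ _) _.
  apply: le_trans (lerD (lexx _) (enorm_dist_triangle (iter j.+1 S w) _ _)) _.
  have := firmly_nonexpansive_enorm (iter j S w) w.
  have := d_noninc _ _ (ltnW kj); rewrite -/(d j) /= (enorm_distC w).
  lra.
pose v := S w - w.
have step k : iter k.+1 S w - iter k S w = v.
  elim: k => // k <-.
  have := Sfirm (iter k S w) (iter k.+1 S w).
  (* equal lengths leave no room for the second square of firmness *)
  rewrite -/(d k.+1) -/(d k) !dE gerDl => h.
  apply/eqP; rewrite -subr_eq0; apply/eqP/enorm_eq0/eqP.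
  rewrite -sqrf_eq0; apply/eqP/le_anti; rewrite sqr_ge0 andbT.
  rewrite -/(iter k.+1 S w) -/(iter k.+2 S w) in h *.
  by move: h; congr (enorm _ ^+ 2 <= 0); rewrite opprB addrC opprB addrC.
have iterE k : iter k S w - w = k%:R *: v.
  elim: k => [|k IH]; first by rewrite subrr scale0r.
  rewrite -(subrK (iter k S w) (iter _ S w)) step -addrA IH.
  by rewrite -natr1 scalerDl scale1r addrC.
apply/eqP; rewrite -subr_eq0; apply/eqP/enorm_eq0/le_anti.
rewrite enorm_ge0 andbT; apply/ler_addgt0Pr => e e0; rewrite add0r.
have [k k0 kw] := rec e 0 e0; apply: le_trans (ltW kw).
by rewrite iterE enormZ normr_nat ler_peMl ?enorm_ge0// ler1n.
Qed.

Variables (z : nat -> 'cV[R]_n) (z_orbit : forall k, z k.+1 = S (z k)).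

Lemma orbit_iter k j : z (k + j)%N = iter k S (z j).
Proof. by elim: k => //= k <-; rewrite z_orbit. Qed.

(** If z j and z k are both close to w, then S^(k - j) moves w only slightly,
    since it maps z j to z k and is nonexpansive. *)
Lemma orbit_cluster_fixed w : cluster (z k @[k --> \oo]) w -> S w = w.
Proof.
move=> zw; apply: recurrent_fixed => e N e0.
have e20 : 0 < e / 2 by rewrite divr_gt0.
have [j _ jw] := cluster_enorm zw 0 e20.
have [k Njk kw] := cluster_enorm zw (N.+1 + j) e20.
have jk : (j <= k)%N by apply: leq_trans Njk; rewrite leq_addl.
exists (k - j)%N; first by rewrite ltn_subRL addnC.
have := iter_nonexpansive (k - j) w (z j); rewrite -orbit_iter subnK// => h.
apply: le_lt_trans (enorm_dist_triangle (z k) _ _) _.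
move: h jw kw; rewrite (enorm_distC w); lra.
Qed.

Lemma orbit_dist_fixed_noninc w i j : S w = w -> (i <= j)%N ->
  enorm (z j - w) <= enorm (z i - w).
Proof.
move=> Sw /subnK <-; rewrite orbit_iter.
have {1}-> : w = iter (j - i) S w by elim: (j - i)%N => //= k <-.
exact: iter_nonexpansive.
Qed.

Lemma orbit_cluster_cvg w : cluster (z k @[k --> \oo]) w ->
  z k @[k --> \oo] --> w.
Proof.
move=> zw; have Sw := orbit_cluster_fixed zw.
apply: enorm_cvg => e e0; have [N _ Nw] := cluster_enorm zw 0 e0.
exists N => // k Nk; exact: le_lt_trans (orbit_dist_fixed_noninc Sw Nk) Nw.
Qed.

Lemma orbit_fixed_not_cvg_pinfty w : S w = w -> ~ (enorm (z k) @[k --> \oo] --> +oo).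
Proof.
move=> Sw /cvgryPgt/(_ (enorm (z 0 - w) + enorm w))[N _ /(_ N (leqnn N))] /=.
apply/negP; rewrite -leNgt -{1}(subrK w (z N)).
by apply: le_trans (enormD _ _) _; rewrite lerD2r orbit_dist_fixed_noninc.
Qed.

Lemma orbit_cvg w : S w = w -> exists zstar : 'cV[R]_n, z k @[k --> \oo] --> zstar.
Proof.
move=> /orbit_fixed_not_cvg_pinfty/not_cvg_pinfty_cluster[zstar zz].
by exists zstar; exact: orbit_cluster_cvg.
Qed.

Lemma orbit_diverges : (forall w, S w <> w) -> enorm (z k) @[k --> \oo] --> +oo.
Proof.
move=> noFix; apply: contrapT => /not_cvg_pinfty_cluster[w].
by move=> /orbit_cluster_fixed; exact: noFix.
Qed.

End Iterates.
End FirmlyNonexpansive.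

(** * The null space *)

Section NullSpace.
Context {R : realType} {m n : nat}.
Variables (A : 'M[R]_(m, n)) (A_free : row_free A).

(** If v A A^T = 0 then |v A|^2 = 0, and the rows of A are independent. *)
Lemma gram_unitmx : A *m A^T \in unitmx.
Proof.
rewrite -row_free_unit; apply: inj_row_free => v vAA.
apply/eqP; rewrite -(mulmx_free_eq0 _ A_free); apply/eqP.
apply: trmx_inj; rewrite trmx0; apply: dotpxx_eq0.
by rewrite /dotp trmxK trmx_mul !mulmxA -(mulmxA v) vAA mul0mx mxE.
Qed.

Lemma mulmx_Dmx : A *m Dmx A = 0.
Proof. by rewrite /Dmx mulmxBr mulmx1 !mulmxA mulmxV ?gram_unitmx// mul1mx subrr. Qed.

Lemma Dmx_trmx : Dmx A *m A^T = 0.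
Proof. by rewrite /Dmx mulmxBl mul1mx -!mulmxA mulVmx ?gram_unitmx// mulmx1 subrr. Qed.

Lemma DmxE (x : 'cV[R]_n) : Dmx A *m x = x - A^T *m (invmx (A *m A^T) *m (A *m x)).
Proof. by rewrite /Dmx mulmxBl mul1mx !mulmxA. Qed.

Lemma Dmx_null (x : 'cV[R]_n) : A *m x = 0 -> Dmx A *m x = x.
Proof. by move=> Ax; rewrite DmxE Ax !mulmx0 subr0. Qed.

(** The angle is a right angle: x - D x lies in the range of A^T. *)
Lemma obtuse_at_null_space x : obtuse_at (null_space A) x (Dmx A *m x).
Proof.
split=> [|q Aq]; first by rewrite /null_space /= mulmxA mulmx_Dmx mul0mx.
rewrite [X in dotp (_ - X) _]DmxE subKr /dotp trmx_mul trmxK -(mulmxA _ A).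
by rewrite mulmxBr Aq (mulmxA A) mulmx_Dmx mul0mx subrr mulmx0 mxE.
Qed.

Lemma null_space_has_obtuse_points : has_obtuse_points (null_space A).
Proof. by move=> x; exists (Dmx A *m x); exact: obtuse_at_null_space. Qed.

Lemma proj_null_space x : proj (null_space A) x = Dmx A *m x.
Proof. exact/proj_eq/obtuse_at_null_space. Qed.

End NullSpace.

(** * Fixed points *)

Section FixedPoints.
Context {R : realType} {m n : nat}.
Variables (K : set 'cV[R]_n) (A : 'M[R]_(m, n)) (c : 'cV[R]_n) (gamma : R).
Hypotheses (K_obtuse : has_obtuse_points K) (K_convex : convex_set K)
  (K_cone : is_cone K) (A_free : row_free A) (gamma_gt0 : 0 < gamma).

Lemma coneZ l x : 0 < l -> K x -> K (l *: x).
Proof.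
move=> l0 Kx; have : [set l *: y | y in K] (l *: x) by exists x.
by rewrite -K_cone.
Qed.

Lemma coneD x y : K x -> K y -> K (x + y).
Proof.
move=> Kx Ky.
have h0 : 0 <= 2^-1 :> R by rewrite invr_ge0.
have h1 : 2^-1 <= 1 :> R by rewrite invf_le1// ler1n.
have := @K_convex x y (Itv01 h0 h1); rewrite !inE => /(_ Kx Ky).
move=> /(@coneZ 2); rewrite ltr0Sn => /(_ isT); congr K.
rewrite [X in _ *: X](_ : _ = 2^-1 *: x + (1 - 2^-1) *: y) //.
by apply/matrixP => i j; rewrite !mxE; lra.
Qed.

(** The projection p of 0 satisfies the obtuse angle condition against p / 2,
    which forces p = 0. *)
Lemma cone0 : K 0.
Proof.
have [Kp /(_ _ (coneZ _ Kp)) obt] := proj_obtuse 0 K_obtuse.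
suff <- : proj K 0 = 0 by [].
apply/dotpxx_eq0/le_anti; rewrite dotpxx_ge0 andbT.
have /obt : 0 < 2^-1 :> R by rewrite invr_gt0.
by rewrite sub0r !dotp_linE; lra.
Qed.

(** Moreau: for v in K the point P_K x + v is in K, and the obtuse angle condition
    against it is the claim. *)
Lemma proj_sub_dual_cone x : dual_cone K (proj K x - x).
Proof.
have [Kp obt] := proj_obtuse x K_obtuse.
by move=> v /(coneD Kp)/obt; rewrite addrAC subrr add0r -opprB dotpNl oppr_le0.
Qed.

Lemma proj_opp_dual_cone s : dual_cone K s -> proj K (- s) = 0.
Proof.
move=> sK; apply: proj_eq; split; first exact: cone0.
by move=> q /sK; rewrite !subr0 dotpNl oppr_le0.
Qed.

(** Since the reflection across the null space is 2 D - id, the fixed point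
    equation solves for P_K z, which thereby lies in the null space. *)
Lemma fixed_eqP z : (Ttilde K A z - gamma *: (Dmx A *m c) = z) <->
  proj K z = Dmx A *m (2 *: proj K z - z - gamma *: c).
Proof.
rewrite /Ttilde {1}/reflector proj_null_space// /reflector.
set w := 2 *: _ - z; rewrite (mulmxBr _ w) -scalemxAr.
move: (Dmx A *m w) (Dmx A *m c) => u v; rewrite {}/w.
by split=> /matrixP h; apply/matrixP => i j; have := h i j; rewrite !mxE; lra.
Qed.

Lemma fixed_dual_feasible z : Ttilde K A z - gamma *: (Dmx A *m c) = z ->
  dual_feasible K A c.
Proof.
move=> /fixed_eqP; have pz := @proj_sub_dual_cone z.
set p := proj K z in pz * => pE.
(* the dual slack encoded by the fixed point z *)
pose s := gamma^-1 *: (p - z).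
have sE : gamma *: s = p - z by rewrite scalerA mulfV ?scale1r ?gt_eqF.
have Ap : A *m p = 0 by rewrite pE mulmxA mulmx_Dmx// mul0mx.
have : Dmx A *m (gamma *: (s - c)) = 0.
  rewrite scalerBr sE; have := pE; rewrite -{1}(Dmx_null Ap).
  move=> /eqP; rewrite eq_sym -subr_eq0 -mulmxBr => /eqP <-; congr (_ *m _).
  by apply/matrixP => i j; rewrite !mxE; lra.
rewrite -scalemxAr => /eqP; rewrite scaler_eq0 gt_eqF//= DmxE subr_eq0 => /eqP scE.
exists (- (invmx (A *m A^T) *m (A *m (s - c))), s); split=> /=.
  by rewrite mulmxN -scE opprB subrK.
move=> v /pz; rewrite dotpZl => ?; rewrite mulr_ge0// invr_ge0 ltW//.
Qed.

Lemma dual_feasible_fixed y s : A^T *m y + s = c -> dual_cone K s ->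
  Ttilde K A (- (gamma *: s)) - gamma *: (Dmx A *m c) = - (gamma *: s).
Proof.
move=> cE sK; apply/fixed_eqP; rewrite proj_opp_dual_cone; last first.
  by move=> v /sK ?; rewrite dotpZl mulr_ge0// ltW.
rewrite scaler0 sub0r opprK -scalerBr -cE opprD addrCA subrr addr0.
by rewrite -scalemxAr mulmxN mulmxA Dmx_trmx// mul0mx oppr0 scaler0.
Qed.

End FixedPoints.

Theorem theorem11 (R : realType) (m n : nat) (K : set 'cV[R]_n)
    (c : 'cV[R]_n) (b : 'cV[R]_m) (A : 'M[R]_(m, n))
    (K_nonempty : K !=set0) (K_closed : closed K) (K_convex : convex_set K)
    (K_cone : is_cone K)
    (m_le_n : (m <= n)%N) (A_full_rank : \rank A = minn m n)
    (gamma : R) (gamma_gt0 : 0 < gamma)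
    (z : nat -> 'cV[R]_n)
    (z_iter : forall k, z k.+1 = Ttilde K A (z k) - gamma *: (Dmx A *m c)) :
  (dual_feasible K A c ->
     exists zstar : 'cV[R]_n, z k @[k --> \oo] --> zstar) /\
  (~ dual_feasible K A c ->
     enorm (z k) @[k --> \oo] --> +oo).
Proof.
have K_obtuse := closed_convex_has_obtuse_points K_nonempty K_closed K_convex.
have A_free : row_free A by rewrite /row_free A_full_rank (minn_idPl m_le_n).
pose S x := Ttilde K A x - gamma *: (Dmx A *m c).
have Sfirm : firmly_nonexpansive S.
  apply/firmly_nonexpansive_translate/firmly_nonexpansive_average => x y.
  apply: le_trans (reflector_nonexpansive _ _ K_obtuse).
  exact/reflector_nonexpansive/null_space_has_obtuse_points.
split=> [[[y s] [cE sK]]|infeasible].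
  by apply: (orbit_cvg Sfirm z_iter); exact: dual_feasible_fixed cE sK.
apply: (orbit_diverges Sfirm z_iter) => w /fixed_dual_feasible.
by move=> /(_ K_obtuse K_convex K_cone A_free gamma_gt0).
Qed.
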